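(* Let $G$ be a random bipartite graph $B(m,n,p)$, and put $N=m+n$ and $s=\min(m,n)$. Suppose $p^2s\gg\log N$. Then $$\lim_{N\to\infty}\Pr\left(G\text{ is positively curved}\right)=1.$$ Explicitly: for any sequences of positive integers $m_k,n_k$ and of $p_k\in[0,1]$ with $N_k=m_k+n_k\to\infty$ and $p_k^2\min(m_k,n_k)/\log N_k\to\infty$ as $k\to\infty$, the probability that a random graph $B(m_k,n_k,p_k)$ is positively curved tends to $1$.
   Context: The random bipartite graph $B(m,n,p)$ has two fixed parts $X,Y$ of sizes $m$ and $n$, and each of the $mn$ possible edges between $X$ and $Y$ is present independently with probability $p$. A graph is positively curved if $\kappa_{\mathrm{LLY}}(x,y)>0$ for each of its edges $xy$. All graphs are finite and simple. Let $\rho$ denote graph distance and $d_x$ the degree of a vertex $x$. For probability measures $\mu_1,\mu_2$ on $V(G)$, the $L^1$-Wasserstein distance is $W(\mu_1,\mu_2)=\inf_\pi\sum_{u,v\in V}\rho(u,v)\pi(u,v)$, the infimum over $\pi:V\times V\to[0,1]$ with $\sum_v\pi(u,v)=\mu_1(u)$ for all $u$ and $\sum_u\pi(u,v)=\mu_2(v)$ for all $v$. For $\alpha\in[0,1]$ and a vertex $x$, $\mu_x^\alpha$ is the measure with $\mu_x^\alpha(x)=\alpha$, $\mu_x^\alpha(z)=\frac{1-\alpha}{d_x}$ if $z$ is adjacent to $x$, and $0$ otherwise. For an edge $xy$ (so $\rho(x,y)=1$), $\kappa_\alpha(x,y)=1-W(\mu_x^\alpha,\mu_y^\alpha)$ and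 the Lin--Lu--Yau curvature is $\kappa_{\mathrm{LLY}}(x,y)=\lim_{\alpha\to1^-}\frac{\kappa_\alpha(x,y)}{1-\alpha}$. (For edges, all the measures involved are supported in one connected component.) *)

(* Defs.v *)
From HB Require Import structures.
From mathcomp Require Import all_boot all_order all_algebra.
From mathcomp Require Import all_classical all_reals all_analysis.

Set Implicit Arguments.
Unset Strict Implicit.
Unset Printing Implicit Defensive.

Import Order.TTheory GRing.Theory Num.Theory.
Import numFieldNormedType.Exports.

Local Open Scope classical_set_scope.
Local Open Scope ring_scope.

Section Curvature.

(* A finite simple graph is encoded by its adjacency relation; symmetry and
   irreflexivity are proved below for the graphs of the random model. *)
Variables (T : finType) (e : rel T).

Definition walk (k : nat) (x y : T) : bool :=
  [exists w : k.-tuple T, path e x w && (last x w == y)].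

(* A shortest walk has length smaller than #|T|.  Vertices in distinct
   components get the junk value #|T|; it never affects the curvature of an
   edge, since a coupling of two measures supported in one component vanishes
   on all pairs not contained in that component. *)
Definition graph_dist (x y : T) : nat :=
  \big[minn/#|T|]_(k < #|T| | walk k x y) k.

Definition degree (x : T) : nat := #|[set z | e x z]%SET|.

Variable R : realType.

Definition coupling (mu1 mu2 : T -> R) (pi : T -> T -> R) : Prop :=
  [/\ forall u v, 0 <= pi u v <= 1,
      forall u, \sum_v pi u v = mu1 u &
      forall v, \sum_u pi u v = mu2 v].

Definition wasserstein (mu1 mu2 : T -> R) : R :=
  inf [set \sum_u \sum_v (graph_dist u v)%:R * pi u v
      | pi in coupling mu1 mu2].

Definition lazy_walk (alpha : R) (x z : T) : R :=
  if z == x then alpha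
  else if e x z then (1 - alpha) / (degree x)%:R
  else 0.

Definition kappa (alpha : R) (x y : T) : R :=
  1 - wasserstein (lazy_walk alpha x) (lazy_walk alpha y).

Definition kappa_LLY (x y : T) : R :=
  lim (kappa alpha x y / (1 - alpha) @[alpha --> 1^'-]).

Definition positively_curved : Prop :=
  forall x y, e x y -> 0 < kappa_LLY x y.

End Curvature.

Section RandomBipartite.
Variables (m n : nat).

Definition bip_adj (E : {set 'I_m * 'I_n}) : rel ('I_m + 'I_n) :=
  fun a b => match a, b with
  | inl i, inr j | inr j, inl i => (i, j) \in E
  | _, _ => false
  end.

Lemma bip_adj_sym (E : {set 'I_m * 'I_n}) : symmetric (bip_adj E).
Proof. by move=> [i|j] [i'|j']. Qed.

Lemma bip_adj_irr (E : {set 'I_m * 'I_n}) : irreflexive (bip_adj E).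
Proof. by move=> [i|j]. Qed.

Variables (R : realType) (p : R).

(* The probability that the edge set of B(m,n,p) is exactly [E]. *)
Definition bip_weight (E : {set 'I_m * 'I_n}) : R :=
  \prod_(ij : 'I_m * 'I_n) (if ij \in E then p else 1 - p).

Definition bip_prob (A : rel ('I_m + 'I_n) -> Prop) : R :=
  \sum_(E : {set 'I_m * 'I_n} | `[< A (bip_adj E) >]) bip_weight E.

End RandomBipartite.

(* Main.v *)
Require Import Defs.
From mathcomp Require Import all_boot all_order all_algebra.
From mathcomp Require Import all_classical all_reals all_analysis.
From mathcomp Require Import zify ring lra.

(* The ratio [kappa_alpha / (1 - alpha)] is nondecreasing and bounded, so an
   edge is positively curved as soon as, at laziness 1/2, some coupling costs
   less than 1.  If [d_x <= d_y], such a coupling exists when the rest of the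
   neighbourhood of [x], each vertex carrying mass [1/d_x], can be sent along
   edges into the rest of the neighbourhood of [y], each vertex receiving at
   most [1/d_y].  By Hall's theorem applied to [d_y] copies of the former and
   [d_x] copies of the latter, this is an expansion condition on pairs of
   neighbourhoods.

   With [N = m + n] and [D = p min(m,n) / 4], it follows from: all degrees are
   at least [D], and every nonempty set [S] of other vertices of the part of
   [x] reaches at least [min(2/3, 2 |S| / D)] of the neighbourhood of [x].
   Conditionally on this neighbourhood [C], the failure probability is bounded
   by a union over [S] and over the reached set [U] of [C]: each pair
   contributes [(1-p)^(|S| |C \ U|) <= N^(-|U|) N^(-3|S|)] when
   [p D >= 15 ln N], which sums to O(1/N). *)

Import Order.TTheory GRing.Theory Num.Theory.
Import numFieldNormedType.Exports.

Local Open Scope classical_set_scope.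
Local Open Scope ring_scope.

(** * Curvature and couplings *)

Definition transport_cost {T : finType} (e : rel T) {R : realType}
    (pi : T -> T -> R) : R :=
  \sum_u \sum_v (graph_dist e u v)%:R * pi u v.

Lemma graph_dist_le {T : finType} (e : rel T) k (x y : T) :
  walk e k x y -> (graph_dist e x y <= k)%N.
Proof.
move=> w; rewrite /graph_dist; case: (ltnP k #|T|) => [kT|Tk].
  have := mem_index_enum (Ordinal kT);
  elim: index_enum => // i r IH; rewrite inE big_cons => /predU1P[<-|/IH le_r].
    by rewrite w geq_minl.
  by case: ifP => // _; apply: leq_trans (geq_minr _ _) le_r.
(* The minimum starts from [#|T|], so it never exceeds this default value. *)
apply: leq_trans Tk; elim/big_rec: _ => // i m _ le_m.
exact: leq_trans (geq_minr _ _) le_m.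
Qed.

Lemma walk0 {T : finType} (e : rel T) (x : T) : walk e 0 x x.
Proof. by apply/existsP; exists [tuple]; rewrite /= eqxx. Qed.

Lemma walkS {T : finType} (e : rel T) k (x y z : T) :
  e x y -> walk e k y z -> walk e k.+1 x z.
Proof.
move=> exy /existsP[w /andP[pw lw]].
by apply/existsP; exists [tuple of y :: w]; rewrite /= exy pw.
Qed.

Lemma graph_dist_gt0 {T : finType} (e : rel T) (x y : T) :
  x != y -> (0 < graph_dist e x y)%N.
Proof.
move=> xy; rewrite /graph_dist; elim/big_rec: _ => [|i m wi m0].
  by apply/card_gt0P; exists x.
rewrite leq_min m0 andbT; case: i wi => -[|//] /= _ /existsP[w].
by rewrite (tuple0 w) /= (negbTE xy).
Qed.

Section Curvature.
Context {T : finType} {R : realType}.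
Variable e : rel T.
Hypotheses (e_sym : symmetric e) (e_irr : irreflexive e).

Local Notation mu := (@lazy_walk T e R).

Lemma transport_cost_ge0 (mu1 mu2 : T -> R) pi :
  coupling mu1 mu2 pi -> 0 <= transport_cost e pi.
Proof.
move=> [pi01 _ _]; apply: sumr_ge0 => u _; apply: sumr_ge0 => v _.
by rewrite mulr_ge0 //; case/andP: (pi01 u v).
Qed.

Lemma wasserstein_le (mu1 mu2 : T -> R) pi :
  coupling mu1 mu2 pi -> wasserstein e mu1 mu2 <= transport_cost e pi.
Proof.
move=> cpi; apply: ge_inf; last by exists pi.
by exists 0 => _ [pi' cpi' <-]; apply: transport_cost_ge0 cpi'.
Qed.

(** A coupling has to be supplied because [inf] takes a default value on the empty set. *)
Lemma le_wasserstein (mu1 mu2 : T -> R) c :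
    (exists pi, coupling mu1 mu2 pi) ->
    (forall pi, coupling mu1 mu2 pi -> c <= transport_cost e pi) ->
  c <= wasserstein e mu1 mu2.
Proof.
move=> [pi cpi] lec; apply: lb_le_inf; first by exists (transport_cost e pi), pi.
by move=> _ [pi' cpi' <-]; apply: lec.
Qed.

Lemma transport_cost_tr (pi : T -> T -> R) :
  transport_cost e (fun u v => pi v u) = transport_cost e pi.
Proof.
have dC u v : graph_dist e u v = graph_dist e v u.
  have wC k a b : walk e k a b -> walk e k b a.
    elim: k a b => [|k IH] a b /existsP[w].
      by rewrite (tuple0 w) /= => /eqP->; apply: walk0.
    case/andP; case/tupleP: w => c w /= /andP[eac pw] lw.
    have {pw lw}: walk e k b c by apply/IH/existsP; exists w; rewrite pw.
    move=> /existsP[w' /andP[pw' /eqP lw']].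
    apply/existsP; exists [tuple of rcons w' a].
    by rewrite /= rcons_path pw' lw' e_sym eac last_rcons eqxx.
  by apply: eq_bigl => k; apply/idP/idP; apply: wC.
rewrite /transport_cost exchange_big /=; apply: eq_bigr => u _.
by apply: eq_bigr => v _; rewrite dC.
Qed.

Lemma coupling_tr (mu1 mu2 : T -> R) pi :
  coupling mu1 mu2 pi -> coupling mu2 mu1 (fun u v => pi v u).
Proof. by move=> [h1 h2 h3]; split. Qed.

Lemma sum_if_adj (x : T) (c : R) :
  \sum_z (if e x z then c else 0) = c *+ degree e x.
Proof.
rewrite -big_mkcond /= sumr_const /degree; congr (_ *+ _).
by apply: eq_card => z; rewrite !inE.
Qed.

(* The walk measures are affine in the laziness, and are point masses at
   laziness 1. *)
Lemma coupling_lazier (x y : T) (a l : R) pi :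
    0 <= l <= 1 -> coupling (mu a x) (mu a y) pi ->
  coupling (mu (1 - l * (1 - a)) x) (mu (1 - l * (1 - a)) y)
    (fun u v => l * pi u v + (1 - l) * ((u == x) && (v == y))%:R).
Proof.
move=> /andP[l0 l1] [pi01 row col].
have muE w z : mu (1 - l * (1 - a)) w z = l * mu a w z + (1 - l) * (z == w)%:R.
  rewrite /lazy_walk; case: eqP => _; first by rewrite mulr1; ring.
  by case: ifP => _; rewrite !mulr0 !addr0 ?mulr0 // opprB addrC subrK mulrA.
split => [u v|u|v].
- have /andP[p0 p1] := pi01 u v.
  by case: ((u == x) && _); rewrite ?mulr1 ?mulr0; apply/andP; split; nra.
- rewrite muE big_split /= -!mulr_sumr row; congr (_ + _ * _).
  rewrite (bigD1 y) //= eqxx andbT big1 ?addr0 // => v vy.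
  by rewrite (negbTE vy) andbF.
- rewrite muE big_split /= -!mulr_sumr col; congr (_ + _ * _).
  rewrite (bigD1 x) //= eqxx big1 ?addr0 // => u ux.
  by rewrite (negbTE ux).
Qed.

Lemma transport_cost_lazier (x y : T) (l : R) pi :
  transport_cost e (fun u v => l * pi u v + (1 - l) * ((u == x) && (v == y))%:R)
  = l * transport_cost e pi + (1 - l) * (graph_dist e x y)%:R.
Proof.
rewrite /transport_cost.
under eq_bigr do under eq_bigr do rewrite mulrDr mulrCA (mulrCA _ (1 - l)).
under eq_bigr do rewrite big_split /= -!mulr_sumr.
rewrite big_split /= -!mulr_sumr; congr (_ + _ * _).
rewrite (bigD1 x) //= (bigD1 y) //= !eqxx mulr1 !big1 ?addr0 // => [u ux|v vy].
  by rewrite big1 // => v _; rewrite (negbTE ux) mulr0.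
by rewrite (negbTE vy) mulr0.
Qed.

(** Under the walk at [y], the vertices other than [y] carry mass at most [1 - a]. So at least
    [a - (1 - a)] of the mass [a] at [x] must go to [y], at distance at least 1. *)
Lemma kappa_le (x y : T) (a : R) :
    e x y -> a <= 1 -> (exists pi, coupling (mu a x) (mu a y) pi) ->
  kappa e a x y <= 2 * (1 - a).
Proof.
move=> exy a1 ex.
suff: 1 - 2 * (1 - a) <= wasserstein e (mu a x) (mu a y) by rewrite /kappa; lra.
apply: le_wasserstein ex _ => pi cpi; have [pi01 row col] := cpi.
have pi0 u v : 0 <= pi u v by case/andP: (pi01 u v).
have xy : x != y by apply: contraTneq exy => ->; rewrite e_irr.
have rx : \sum_v pi x v = a by rewrite row /lazy_walk eqxx.
have mass : \sum_(v | v != y) pi x v <= 1 - a.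
  apply: (@le_trans _ _ (\sum_v (if e y v then (1 - a) / (degree e y)%:R else 0))).
    rewrite [X in _ <= X](bigD1 y) //= e_irr add0r; apply: ler_sum => v vy.
    apply: (@le_trans _ _ (\sum_u pi u v)).
      by rewrite (bigD1 x) //= lerDl sumr_ge0.
    by rewrite col /lazy_walk (negbTE vy).
  rewrite sum_if_adj -[X in X <= _]mulr_natr divfK // pnatr_eq0 -lt0n.
  by apply/card_gt0P; exists x; rewrite inE e_sym.
have pxy : 1 - 2 * (1 - a) <= pi x y.
  by move: rx mass; rewrite (bigD1 y) //=; lra.
apply: le_trans pxy _; rewrite /transport_cost (bigD1 x) //= (bigD1 y) //= -addrA.
apply: ler_wpDr; last by rewrite ler_peMl // ler1n graph_dist_gt0.
by rewrite addr_ge0 // !sumr_ge0 // => *; rewrite ?sumr_ge0 // => *; rewrite mulr_ge0.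
Qed.

(* [kappa a x y / (1 - a)] is nondecreasing in [a] and bounded, so its limit
   exists and is at least its value at [1/2]. *)
Lemma kappa_LLY_gt0 (x y : T) pi :
    e x y -> coupling (mu 2^-1 x) (mu 2^-1 y) pi -> transport_cost e pi < 1 ->
  0 < kappa_LLY e R x y.
Proof.
move=> exy cpi cost.
have dxy : (graph_dist e x y)%:R <= 1 :> R.
  by rewrite lern1; apply: graph_dist_le; apply: walkS exy (walk0 _ _).
have exc a : 2^-1 <= a -> a < 1 -> exists pi', coupling (mu a x) (mu a y) pi'.
  move=> a2 a1; rewrite (_ : a = 1 - (2 * (1 - a)) * (1 - 2^-1)); last by field.
  by eexists; apply: coupling_lazier cpi; apply/andP; split; lra.
pose h (a : R) := kappa e a x y / (1 - a).
have hmono a b : 2^-1 <= a -> a <= b -> b < 1 -> h a <= h b.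
  move=> a2 ab b1; have a1 : a < 1 by apply: le_lt_trans b1.
  (* The walks at laziness [b] are mixtures of those at laziness [a], with weight [l], and of point
     masses. A coupling at [a] thus gives one at [b] whose cost is at most [l] times the old cost
     plus [1 - l]. *)
  pose l := (1 - b) / (1 - a).
  have l01 : 0 < l <= 1 by rewrite /l divr_gt0 ?ler_pdivrMr /=; lra.
  have bE : b = 1 - l * (1 - a) by rewrite /l; field; lra.
  have {}l0 : 0 < l by case/andP: l01.
  have kab : l * kappa e a x y <= kappa e b x y.
    have: (wasserstein e (mu b x) (mu b y) - (1 - l)) / l
            <= wasserstein e (mu a x) (mu a y).
      apply: le_wasserstein (exc _ a2 a1) _ => pi' cpi'.
      rewrite ler_pdivrMr // lerBlDr.
      have l01' : 0 <= l <= 1 by case/andP: l01 => /ltW-> ->.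
      have := wasserstein_le _ _ _ (coupling_lazier _ _ _ _ _ l01' cpi').
      rewrite -bE transport_cost_lazier => /le_trans; apply.
      rewrite mulrC lerD2l ler_piMr //; case/andP: l01'; lra.
    by rewrite ler_pdivrMr // /kappa; lra.
  rewrite /h ler_pdivlMr ?subr_gt0 // (_ : _ * (1 - b) = l * kappa e a x y) //.
  by rewrite /l; field; lra.
have h0 : 0 < h 2^-1.
  rewrite /h divr_gt0 //; last by lra.
  by rewrite /kappa subr_gt0; apply: le_lt_trans cost; apply: wasserstein_le.
apply: lt_le_trans h0 _; rewrite /kappa_LLY.
have half_lt1 : 2^-1 < 1 :> R by lra.
apply: limr_ge; last first.
  near=> a; apply: hmono => //.
  near: a; exact: nbhs_left_ge.
(* Convergence must be established, since [lim] is a default value otherwise; the ratio is bounded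
   above by 2. *)
apply: nondecreasing_at_left_is_cvgr.
  near=> a => b c; rewrite !in_itv /= => /andP[ab b1] /andP[ac c1] bc.
  apply: hmono => //; apply: le_trans (ltW ab).
  near: a; exact: nbhs_left_ge.
near=> a; exists 2 => _ [b + <-]; rewrite /= in_itv /= => /andP[ab b1].
rewrite ler_pdivrMr ?subr_gt0 // kappa_le //; first exact: ltW.
apply: exc => //; apply: le_trans (ltW ab).
near: a; exact: nbhs_left_ge.
Unshelve. all: by end_near. Qed.

End Curvature.

(** * Hall's theorem *)

Section Hall.
Context {I J : finType}.
Variable r : I -> J -> bool.

Definition image_rel (S : {set I}) : {set J} :=
  [set j | [exists i in S, r i j]]%SET.

Lemma image_relP (S : {set I}) j :
  reflect (exists2 i, i \in S & r i j) (j \in image_rel S).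
Proof. by rewrite inE; apply: exists_inP. Qed.

Lemma image_relU (S S' : {set I}) :
  image_rel (S :|: S')%SET = (image_rel S :|: image_rel S')%SET.
Proof.
apply/setP => j; rewrite finset.in_setU; apply/image_relP/orP => [[i]|].
  by rewrite finset.in_setU => /orP[] iS rij; [left|right]; apply/image_relP; exists i.
by case=> /image_relP[i iS rij]; exists i; rewrite // finset.in_setU iS ?orbT.
Qed.

(** Induction on the size of [A], with [B] collecting the targets already taken. If a nonempty
    proper subset is tight, it is matched first and the rest avoids everything it reaches; otherwise
    one point is matched and its target deleted. [j0] provides a total function when [A] is
    empty. *)
Lemma hall_avoiding (j0 : J) k (A : {set I}) (B : {set J}) :
    (#|A| <= k)%N ->
    (forall S : {set I}, S \subset A -> (#|S| <= #|image_rel S :\: B|)%N) ->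
  exists2 f : I -> J, {in A &, injective f}
    & {in A, forall i, r i (f i) /\ f i \notin B}.
Proof.
elim: k A B => [|k IH] A B cA hallA; have [A0|[a aA]] := set_0Vmem A.
- by exists (fun=> j0) => i; rewrite A0 inE.
- by move: cA; rewrite leqn0 cards_eq0 => /eqP A0; rewrite A0 inE in aA.
- by exists (fun=> j0) => i; rewrite A0 inE.
pose tight S := [&& S != finset.set0, S \proper A & (#|image_rel S :\: B| <= #|S|)%N].
have [S /and3P[S0 SA tS]|loose] := pickP tight.
  have sSA := proper_sub SA.
  have cS : (#|S| < #|A|)%N by apply: proper_card.
  have [f1 inj1 f1P] : exists2 f : I -> J, {in S &, injective f}
      & {in S, forall i, r i (f i) /\ f i \notin B}.
    apply: IH => [|S' sS']; first exact: leq_trans cS cA.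
    by apply: hallA; apply: fintype.subset_trans sS' sSA.
  have [f2 inj2 f2P] : exists2 f : I -> J, {in A :\: S &, injective f}
      & {in A :\: S, forall i, r i (f i) /\ f i \notin B :|: image_rel S}%SET.
    apply: IH => [|S' sS'].
      move: cA; rewrite -(cardsID S A) (finset.setIidPr sSA) => cA.
      by rewrite -ltnS; apply: leq_trans cA; rewrite -[ltnLHS]add0n ltn_add2r card_gt0.
    have dis : (S' :&: S = finset.set0)%SET.
      apply/eqP; rewrite -finset.subset0; apply/fintype.subsetP => i.
      rewrite !inE => /andP[/(fintype.subsetP sS')].
      by rewrite !inE => /andP[/negbTE->].
    (* Subtracting the tight contribution of [S] from Hall's condition for [S' :|: S] leaves the
       condition for [S'] with the targets of [S] forbidden. *)
    have := hallA (S' :|: S)%SET; rewrite finset.subUset sSA andbT.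
    rewrite (fintype.subset_trans sS' (finset.subsetDl _ _)) => /(_ isT).
    rewrite cardsU dis cards0 subn0 image_relU => le1.
    have le2 : (#|(image_rel S' :|: image_rel S) :\: B| <=
        #|image_rel S' :\: (B :|: image_rel S)| + #|image_rel S :\: B|)%SET%N.
      apply: leq_trans (leq_card_setU _ _); apply: subset_leq_card.
      apply/fintype.subsetP => j; rewrite !inE.
      by case: (j \in B) => //=; case: [exists _ in S, _]; rewrite /= ?orbT ?orbF.
    by move: (leq_trans le1 le2) tS; lia.
  exists (fun i => if i \in S then f1 i else f2 i) => [i i' iA i'A|i iA].
    have off (u v : I) : u \in S -> v \in A -> v \notin S -> f1 u <> f2 v.
      move=> uS vA vS eq12.
      have [] := f2P v; first by rewrite !inE vS.
      move=> _ /negP[]; rewrite inE -eq12; apply/orP; right.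
      by apply/image_relP; exists u => //; case: (f1P u uS).
    case: ifPn => iS; case: ifPn => i'S eqf.
    - exact: inj1.
    - by case: (off i i').
    - by case: (off i' i).
    - by apply: inj2; rewrite // !inE ?iS ?i'S.
  case: ifPn => iS; first exact: f1P.
  have [|ri fi] := f2P i; first by rewrite !inE iS.
  by split=> //; apply: contra fi => fB; rewrite inE fB.
(* Without tight subsets, every nonempty proper subset has a target to spare, so losing [j]
   preserves Hall's condition. *)
have [j] : exists j, j \in (image_rel [set a] :\: B)%SET.
  by apply/card_gt0P; have := hallA [set a]%SET; rewrite cards1; apply; rewrite finset.sub1set.
rewrite inE => /andP[jB /image_relP[a']]; rewrite inE => /eqP-> raj {a'}.
have [f injf fP] : exists2 f : I -> J, {in A :\ a &, injective f}
    & {in A :\ a, forall i, r i (f i) /\ f i \notin j |: B}%SET.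
  apply: IH => [|S sS]; first by move: cA; rewrite (cardsD1 a) aA.
  have [->|S0] := eqVneq S finset.set0; first by rewrite cards0.
  have prS : S \proper A by apply: sub_proper_trans sS _; rewrite properD1.
  have := loose S; rewrite /tight S0 prS /= => /negbT; rewrite -ltnNge => lt.
  have -> : (image_rel S :\: (j |: B) = (image_rel S :\: B) :\ j)%SET.
    by apply/setP => i; rewrite !inE negb_or andbA.
  by move: lt; rewrite (cardsD1 j); case: (j \in _); rewrite ?add1n ?add0n //; apply: ltnW.
exists (fun i => if i == a then j else f i) => [i i' iA i'A|i iA].
  have off (u : I) : u \in A -> u != a -> f u <> j.
    by move=> uA ua fj; have [] := fP u; rewrite !inE ?ua // fj eqxx.
  case: eqP => [->|/eqP ia]; case: eqP => [->|/eqP i'a] // eqf.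
  - by case: (off i').
  - by case: (off i).
  - by apply: injf; rewrite // !inE ?ia ?i'a.
case: eqP => [->|/eqP ia]; first by split.
have [|ri fi] := fP i; first by rewrite !inE ia.
by split=> //; apply: contra fi => fB; rewrite !inE fB orbT.
Qed.

Lemma hall (j0 : J) (A : {set I}) :
    (forall S : {set I}, S \subset A -> (#|S| <= #|image_rel S|)%N) ->
  exists2 f : I -> J, {in A &, injective f} & {in A, forall i, r i (f i)}.
Proof.
move=> hallA; have [|S SA|f injf fP] := @hall_avoiding j0 #|A| A finset.set0 => //.
  by rewrite finset.setD0; apply: hallA.
by exists f => // i /fP[].
Qed.

End Hall.

(** Hall's theorem is applied to [p] copies of each vertex of [A] and [q] copies of each vertex of
    [B]; [M u v] counts the copies of [u] matched to copies of [v]. *)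
Lemma hall_flow {T : finType} (e : rel T) (A B : {set T}) (p q : nat) :
    (0 < q)%N ->
    (forall S : {set T}, S \subset A ->
      (#|S| * p <= #|image_rel e S :&: B|%SET * q)%N) ->
  exists M : T -> T -> nat,
    [/\ forall u v, (0 < M u v)%N -> [&& u \in A, v \in B & e u v],
        {in A, forall u, (\sum_v M u v = p)%N}
      & forall v, (\sum_u M u v <= q)%N].
Proof.
case: q => // q _ hallA; have [A0|[x0 x0A]] := set_0Vmem A.
  by exists (fun _ _ => 0%N); split=> [u v|u|v] //; [rewrite A0 inE|rewrite big1].
pose r (w : T * 'I_p) (z : T * 'I_q.+1) := e w.1 z.1 && (z.1 \in B).
have [|f injf fP] := hall r (x0, ord0) (finset.setX A [set: 'I_p]%SET).
  (* The projection [S] suffices: [W] has at most [p] copies of each vertex of [S], and it reaches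
     every copy of each vertex of [B] adjacent to [S]. *)
  move=> W WA; pose S := (fst @: W)%SET.
  have SA : S \subset A.
    apply/fintype.subsetP => u /imsetP[w /(fintype.subsetP WA)].
    by case: w => w i; rewrite !inE /= => /andP[wA _] ->.
  have WS : (#|W| <= #|S| * p)%N.
    rewrite -[p in leqRHS]card_ord -finset.cardsT -finset.cardsX; apply: subset_leq_card.
    apply/fintype.subsetP => -[w i] wW; rewrite !inE andbT.
    by apply/imsetP; exists (w, i).
  apply: leq_trans WS (leq_trans (hallA _ SA) _).
  rewrite -[in leqLHS](card_ord q.+1) -finset.cardsT -finset.cardsX; apply: subset_leq_card.
  apply/fintype.subsetP => -[v i]; rewrite finset.in_setX finset.in_setI.
  case/andP=> /andP[/image_relP[_ /imsetP[w wW ->] ewv] vB] _.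
  by apply/image_relP; exists w => //; rewrite /r ewv.
pose M u v := #|[set i : 'I_p | (u \in A) && ((f (u, i)).1 == v)]%SET|.
exists M; split => [u v|u uA|v].
- case/card_gt0P => i; rewrite inE => /andP[uA /eqP <-].
  have /andP[/= -> ->] : r (u, i) (f (u, i)) by apply: fP; rewrite !inE uA.
  by rewrite uA.

- rewrite -[RHS](card_ord p) -sum1_card (partition_big (fun i => (f (u, i)).1) predT) //=.
  by apply: eq_bigr => v _; rewrite /M uA -sum1_card; apply: eq_bigl => i; rewrite inE.
rewrite -[q.+1]card_ord -cardsT.
pose F := [set w in finset.setX A [set: 'I_p]%SET | (f w).1 == v]%SET.
have -> : (\sum_u M u v = #|F|)%N.
  rewrite -sum1_card (partition_big fst predT) //=; apply: eq_bigr => u _.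
  rewrite /M -sum1_card (reindex_onto (fun i => (u, i)) snd) /=.
    by apply: eq_bigl => i; rewrite !inE /= !eqxx !andbT.
  by move=> [u' i] /= /andP[_ /eqP->].
(* Matched copies of a fixed [v] differ in their index, which caps the column sum. *)
have injF : {in F &, injective (fun w => (f w).2)}.
  move=> w w'; rewrite !inE => /andP[wA /eqP v1] /andP[wA' /eqP v2] eq2.
  apply: injf; rewrite ?inE //.
  by rewrite (surjective_pairing (f w)) v1 -v2 eq2 -surjective_pairing.
by rewrite -(card_in_imset injF) subset_leq_card // finset.subsetT.
Qed.

(** * Expansion implies positive curvature *)

Lemma sum_delta {T : finType} {R : pzRingType} (x : T) (F : T -> R) :
  \sum_v (v == x)%:R * F v = F x.
Proof.
rewrite (bigD1 x) //= eqxx mul1r big1 ?addr0 // => v vx.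
by rewrite (negbTE vx) mul0r.
Qed.

Lemma sum_indicator {T : finType} {R : pzRingType} (A : {set T}) (c : R) :
  \sum_v (v \in A)%:R * c = #|A|%:R * c.
Proof.
rewrite -mulr_suml; congr (_ * _); rewrite -sum1_card natr_sum [RHS]big_mkcond /=.
by apply: eq_bigr => v _; case: (v \in A).
Qed.

Section EdgeCoupling.
Context {T : finType} {R : realType}.
Variable e : rel T.
Hypotheses (e_sym : symmetric e) (e_irr : irreflexive e).

Definition nbrs (x : T) : {set T} := [set z | e x z]%SET.

Local Notation mu := (@lazy_walk T e R).

(* The walk at [x] keeps mass [1/dy] at [x] and the one at [y] mass [1/dx] at
   [y]; the rest of the neighbours of [x] is sent along edges by [M], the slack
   of [M] is filled from [x] in two steps, and the remaining mass crosses the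
   edge [xy].  With laziness 1/2 the cost is at most [1 - 1/dy]. *)
Lemma flow_coupling (x y : T) (M : T -> T -> nat) :
    e x y -> (degree e x <= degree e y)%N ->
    (forall u v, (0 < M u v)%N ->
       [&& u \in (nbrs x :\ y)%SET, v \in (nbrs y :\ x)%SET & e u v]) ->
    {in (nbrs x :\ y)%SET, forall u, (\sum_v M u v = degree e y)%N} ->
    (forall v, (\sum_u M u v <= degree e x)%N) ->
  exists2 pi, coupling (mu 2^-1 x) (mu 2^-1 y) pi & transport_cost e pi < 1.
Proof.
move=> exy dxy Msupp Mrow Mcol.
have eyx : e y x by rewrite e_sym.
have xy : x != y by apply: contraTneq exy => ->; rewrite e_irr.
pose A := (nbrs x :\ y)%SET; pose B := (nbrs y :\ x)%SET.
pose a : R := (degree e x)%:R^-1; pose b : R := (degree e y)%:R^-1.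
have dx0 : (0 < degree e x)%N by apply/card_gt0P; exists y; rewrite inE.
have dy0 : (0 < degree e y)%N by apply/card_gt0P; exists x; rewrite inE.
have a0 : 0 < a by rewrite invr_gt0 ltr0n.
have b0 : 0 < b by rewrite invr_gt0 ltr0n.
have a1 : a <= 1 by rewrite invf_le1 ?ltr0n // ler1n.
have b1 : b <= 1 by rewrite invf_le1 ?ltr0n // ler1n.
have da : (degree e x)%:R * a = 1 by rewrite mulfV // pnatr_eq0 -lt0n.
have db : (degree e y)%:R * b = 1 by rewrite mulfV // pnatr_eq0 -lt0n.
have cA : #|A|%:R * a = 1 - a.
  have : (degree e x)%:R = 1 + #|A|%:R :> R.
    by rewrite -(natrD _ 1) /degree (cardsD1 y) inE exy.
  by move: da => /[swap] ->; lra.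
have cB : #|B|%:R * b = 1 - b.
  have : (degree e y)%:R = 1 + #|B|%:R :> R.
    by rewrite -(natrD _ 1) /degree (cardsD1 x) inE eyx.
  by move: db => /[swap] ->; lra.
(* Scaled by [a * b], the flow has row sums [a] on [A] and column sums at most [b]. *)
pose mm u v := (M u v)%:R * (a * b).
have mm0 u v : 0 <= mm u v by rewrite mulr_ge0 // mulr_ge0 // ltW.
have mmrow u : \sum_v mm u v = (u \in A)%:R * a.
  rewrite -mulr_suml -natr_sum; have [uA|uA] := boolP (u \in A).
    by rewrite Mrow // mulrCA db mul1r mulr1.
  rewrite big1 ?mul0r // => v _; apply/eqP; rewrite -leqn0 leqNgt.
  by apply: contra uA => /Msupp/and3P[].
pose c v := \sum_u mm u v.
have c0 v : v \notin B -> c v = 0.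
  move=> vB; rewrite /c big1 // => u _; rewrite /mm.
  suff -> : M u v = 0%N by rewrite mul0r.
  apply/eqP; rewrite -leqn0 leqNgt.
  by apply: contra vB => /Msupp/and3P[].
have cb v : c v <= b.
  have bE : b = (degree e x)%:R * (a * b) by rewrite mulrA da mul1r.
  rewrite /c -mulr_suml -natr_sum [leRHS]bE ler_pM2r ?mulr_gt0 //.
  by rewrite ler_nat.
have sumc : \sum_v c v = 1 - a.
  by rewrite exchange_big /= (eq_bigr _ (fun u _ => mmrow u)) sum_indicator.
pose w v := (v \in B)%:R * b - c v.
have w0 v : 0 <= w v.
  by rewrite /w; case: (boolP (v \in B)) => [_|/c0->]; rewrite ?mul1r ?mul0r subr_ge0.
have sumw : \sum_v w v = a - b by rewrite sumrB sum_indicator cB sumc; lra.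
(* Destinations of the mass 1/2 at [x]: [b / 2] stays, [(1 - a) / 2] crosses to [y], and [w / 2]
   fills the slack on [B]. *)
pose g v := (v == x)%:R * (b / 2) + (v == y)%:R * ((1 - a) / 2) + w v / 2.
have g0 v : 0 <= g v by rewrite !addr_ge0 ?mulr_ge0 //; lra.
have sumg : \sum_v g v = 2^-1.
  by rewrite !big_split /= !sum_delta -mulr_suml sumw; field.
pose pi u v := mm u v / 2 + (u == x)%:R * g v + (u == y)%:R * ((v == y)%:R * (a / 2)).
have pi0 u v : 0 <= pi u v by rewrite !addr_ge0 ?mulr_ge0 //; lra.
have row u : \sum_v pi u v = mu 2^-1 x u.
  rewrite !big_split /= -mulr_suml mmrow -!mulr_sumr sumg sum_delta /lazy_walk.
  rewrite !inE; have [->|ux] := eqVneq u x.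
    by rewrite e_irr andbF (negbTE xy) !mul0r /=; lra.
  have [->|uy] := eqVneq u y; first by rewrite exy -/a /=; lra.
  by case: (e x u); rewrite -/a /=; lra.
have col v : \sum_u pi u v = mu 2^-1 y v.
  rewrite !big_split /= -mulr_suml -/(c v) !sum_delta /g /w /lazy_walk.
  rewrite !inE; have [->|vy] := eqVneq v y.
    by rewrite e_irr andbF eq_sym (negbTE xy) /=; lra.
  have [->|vx] := eqVneq v x; first by rewrite eyx -/b /=; lra.
  by case: (e y v); rewrite -/b /=; lra.
exists pi.
  split=> // u v; rewrite pi0 /=.
  apply: (@le_trans _ _ (\sum_v pi u v)).
    by rewrite (bigD1 v) //= lerDl sumr_ge0.
  rewrite row /lazy_walk -/a; case: ifP => _; first lra.
  by case: ifP => _; lra.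
(* Distances are at most 1 along the flow and along [xy], 0 for mass that stays, and at most 2 from
   [x] to [B]; this 2 absorbs the half in [w v / 2]. *)
have dle u v : (graph_dist e u v)%:R * pi u v <=
    mm u v / 2 + (u == x)%:R * ((v == y)%:R * ((1 - a) / 2) + w v).
  set d : R := (graph_dist e u v)%:R.
  have d0 : 0 <= d by rewrite ler0n.
  have d1 k : walk e k u v -> d <= k%:R by move/graph_dist_le; rewrite ler_nat.
  have dmm : d * mm u v <= mm u v.
    have [M0|M0] := posnP (M u v); first by rewrite /mm M0 !mul0r mulr0.
    by rewrite ler_piMl // (d1 1%N) //; case/and3P: (Msupp _ _ M0) => _ _ euv;
       apply: walkS euv (walk0 _ _).
  have dyy : u = y -> v = y -> d = 0.
    by move=> uE vE; apply/eqP; rewrite eq_le d0 andbT (d1 0%N) // uE vE walk0.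
  have dg : u = x -> d * g v <= (v == y)%:R * ((1 - a) / 2) + w v.
    move=> ux; rewrite ux in d1; rewrite /g !mulrDr; apply: lerD.
      rewrite -[leRHS]add0r; apply: lerD.
        have [vx|_] := eqVneq v x; last by rewrite mul0r mulr0.
        have -> : d = 0 by apply/eqP; rewrite eq_le d0 andbT (d1 0%N) // vx walk0.
        by rewrite mul0r.
      have [vy|_] := eqVneq v y; last by rewrite mul0r mulr0.
      rewrite mul1r ler_piMl ?divr_ge0 ?subr_ge0 // (d1 1%N) // vy.
      exact: walkS exy (walk0 _ _).
    rewrite mulrA ler_pdivrMr // [leRHS]mulrC.
    have [vB|vB] := boolP (v \in B); last first.
      by rewrite /w c0 // (negbTE vB) !(mul0r,subr0,mulr0).
    apply: ler_wpM2r => //; apply: (d1 2%N); apply: walkS exy _.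
    by move: vB; rewrite !inE => /andP[_ eyv]; apply: walkS eyv (walk0 _ _).
  rewrite /pi 2!mulrDr; have [uy|uy] := eqVneq u y; last first.
    rewrite mul0r mulr0 addr0 mulrA; apply: lerD; first by rewrite ler_pM2r.
    have [ux|_] := eqVneq u x; last by rewrite !mul0r mulr0.
    by rewrite !mul1r dg.
  have -> : (u == x) = false by rewrite uy eq_sym (negbTE xy).
  rewrite !mul0r mulr0 !addr0 mul1r mulrA.
  rewrite -[leRHS]addr0; apply: lerD; first by rewrite ler_pM2r.
  by have [vy|_] := eqVneq v y; [rewrite dyy // mul0r|rewrite mul0r mulr0].
(* The bounds add up to [(1 - a) / 2] for the flow, [(1 - a) / 2] for the edge [xy] and [a - b] for
   the slack. *)
apply: (@le_lt_trans _ _ (1 - b)); last by rewrite ltrBlDr ltrDl.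
apply: (le_trans (ler_sum _ (fun u _ => ler_sum _ (fun v _ => dle u v)))).
under eq_bigr do rewrite big_split /= -mulr_suml mmrow -mulr_sumr.
rewrite big_split /= sum_delta big_split /= sum_delta -mulr_suml sum_indicator cA sumw.
by lra.
Qed.

End EdgeCoupling.

Section Expansion.
Context {T : finType} {R : realType}.
Variables (e : rel T) (D : R).
Hypotheses (e_sym : symmetric e) (e_irr : irreflexive e).
Hypotheses (degD : forall x, D <= (degree e x)%:R) (D3 : 3 <= D).
(** Taking [S] among the neighbours of a neighbour [z] of [x] places it, in a bipartite graph, in
    the part of [x] without naming the bipartition. *)
Hypothesis expand : forall x z (S : {set T}), e x z ->
  S != finset.set0 -> S \subset (nbrs e z :\ x)%SET ->
  (2 * degree e x <= 3 * #|nbrs e x :&: image_rel e S|%SET)%N \/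
  2 * #|S|%:R * (degree e x)%:R <= D * #|nbrs e x :&: image_rel e S|%SET%:R.

Let expand_nat x y z (S : {set T}) : e x z ->
  S != finset.set0 -> S \subset (nbrs e z :\ x)%SET ->
  (2 * degree e x <= 3 * #|nbrs e x :&: image_rel e S|%SET)%N \/
  (2 * #|S| * degree e x <= degree e y * #|nbrs e x :&: image_rel e S|%SET)%N.
Proof.
move=> exz S0 sS; case: (expand x z S exz S0 sS) => [|h]; [by left|right].
rewrite -(ler_nat R) !natrM; apply: le_trans h _; exact: ler_wpM2r.
Qed.

(* Small [S] expand as seen from [y]; for large [S] apply the expansion as seen
   from [x] to the part of the neighbourhood of [y] that [S] misses. *)
Lemma expansion_hall (x y : T) (S : {set T}) :
    e x y -> (degree e x <= degree e y)%N -> S \subset (nbrs e x :\ y)%SET ->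
  (#|S| * degree e y <= #|image_rel e S :&: (nbrs e y :\ x)|%SET * degree e x)%N.
Proof.
move=> exy dxy sS; have eyx : e y x by rewrite e_sym.
have [->|S0] := eqVneq S finset.set0; first by rewrite cards0.
have s0 : (0 < #|S|)%N by rewrite card_gt0.
have dy3 : (3 <= degree e y)%N by rewrite -(ler_nat R); apply: le_trans (degD y).
have sx : (#|S| + 1 <= degree e x)%N.
  by rewrite /degree (cardsD1 y (nbrs e x)) inE exy addnC leq_add2l subset_leq_card.
pose G := (image_rel e S :&: (nbrs e y :\ x))%SET.
(* The extra 1 is [x] itself, adjacent to every vertex of the nonempty set [S]. *)
have gE : #|nbrs e y :&: image_rel e S|%SET = (1 + #|G|)%N.
  rewrite (cardsD1 x) !inE eyx /=; congr (_ + _)%N.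
    have [u uS] : exists u, u \in S by apply/set0Pn.
    suff -> : [exists i in S, e i x] by [].
    apply/exists_inP; exists u => //; rewrite e_sym.
    by move: (fintype.subsetP sS u uS); rewrite !inE => /andP[].
  by apply: eq_card => v; rewrite !inE andbA [RHS]andbC.
have E1 := expand_nat y x x S eyx S0 sS; rewrite gE in E1.
set g := #|G| in E1 *; pose U := ((nbrs e y :\ x) :\: image_rel e S)%SET.
have tE : (#|U| + g + 1 = degree e y)%N.
  rewrite /degree (cardsD1 x (nbrs e y)) inE eyx addnC; congr (_ + _)%N.
  by rewrite -[RHS](cardsID (image_rel e S)) finset.setIC addnC.
have [U0|U0] := eqVneq U finset.set0.
  move: tE; rewrite U0 cards0 add0n => tE.
  have : ((#|S| + 1) * degree e y <= degree e x * degree e y)%N.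
    by rewrite leq_mul2r sx orbT.
  by rewrite -tE !mulnDl !mulnDr; lia.
have t0 : (0 < #|U|)%N by rewrite card_gt0.
have sU : U \subset (nbrs e y :\ x)%SET by apply: finset.subsetDl.
(* [S] reaches no vertex of [U], so by symmetry [U] reaches no vertex of [S]. *)
have Wle : (#|nbrs e x :&: image_rel e U|%SET + #|S| <= degree e x)%N.
  rewrite /degree -[leqRHS](cardsID S (nbrs e x)) addnC leq_add //.
    rewrite subset_leq_card // finset.subsetI fintype.subxx andbT.
    by apply: fintype.subset_trans sS _; apply: finset.subsetDl.
  rewrite subset_leq_card //; apply/fintype.subsetP => u.
  rewrite !inE => /andP[-> /exists_inP[v]]; rewrite andbT !inE => /andP[nv _] evu.
  by apply: contra nv => uS; apply/exists_inP; exists u; rewrite // e_sym.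
have E2 := expand_nat x y y U exy U0 sU.
set w := #|_ :&: image_rel e U|%SET in Wle E2.
move: E1 E2 Wle tE s0 t0 dy3 dxy sx.
move: #|S| #|U| g w (degree e x) (degree e y).
move=> {sS S0 gE G U U0 sU} s t g w dx dy E1 E2 Wle tE s0 t0 dy3 dxy sx.
rewrite leqNgt; apply/negP => viol.
have dysdy : (dy <= s * dy)%N by rewrite leq_pmull.
(* The linear alternative at [y] would give [s * dy < dx], against [dx <= dy <= s * dy]. So [S]
   reaches two thirds of the neighbours of [y]. *)
case: E1 => [E1|]; last by rewrite mulnDr -mulnA [(dx * g)%N]mulnC; lia.
(* For [3 * s <= dx], two thirds suffice: a violation would force [dy < 3]. *)
have [s_le|s_gt] := leqP (3 * s) dx.
  have : (3 * s * dy <= dx * dy)%N by rewrite leq_mul2r s_le orbT.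
  have : ((2 * dy) * dx <= (3 * (1 + g)) * dx)%N by rewrite leq_mul2r E1 orbT.
  have : (3 * dx <= dy * dx)%N by rewrite leq_mul2r dy3 orbT.
  by rewrite !mulnDr !mulnDl -!mulnA [(dx * dy)%N]mulnC; lia.
(* Two thirds at [x] would leave at most [dx / 3] vertices for [S]. The linear alternative, combined
   with the violation, gives [t * dx < dx]. *)
case: E2 => [E2|E2]; first by lia.
have : (dy * (w + s) <= dy * dx)%N by rewrite leq_mul2l Wle orbT.
have : (1 * dx <= t * dx)%N by rewrite leq_mul2r t0 orbT.
have : ((t + g + 1) * dx = dy * dx)%N by rewrite tE.
rewrite !mulnDr !mulnDl [(dy * s)%N]mulnC; move: E2; rewrite -mulnA; lia.
Qed.

Lemma expansion_positively_curved : positively_curved e R.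
Proof.
have half (x y : T) : e x y -> (degree e x <= degree e y)%N ->
    exists2 pi, coupling (lazy_walk e 2^-1 x) (lazy_walk e 2^-1 y) pi
      & transport_cost e pi < 1 :> R.
  move=> exy dxy.
  have dx0 : (0 < degree e x)%N by apply/card_gt0P; exists y; rewrite inE.
  have [M [h1 h2 h3]] := hall_flow e _ _ _ _ dx0
    (fun S sS => expansion_hall x y S exy dxy sS).
  exact: flow_coupling exy dxy h1 h2 h3.
move=> x y exy; have [dxy|/ltnW dyx] := leqP (degree e x) (degree e y).
  by have [pi cpi cost] := half x y exy dxy; apply: kappa_LLY_gt0 cpi cost.
(* The flow starts from the endpoint of smaller degree, so here the coupling is built for [yx] and
   transposed. *)
have [|pi cpi cost] := half y x _ dyx; first by rewrite e_sym.
apply: (kappa_LLY_gt0 e e_sym e_irr x y _ exy (coupling_tr _ _ _ cpi)).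
by rewrite transport_cost_tr.
Qed.

End Expansion.

(** * Expansion in the random bipartite graph *)

Lemma sum_set_prod {K : finType} {R : comPzRingType} (F G : K -> R) :
  \sum_(S : {set K}) \prod_k (if k \in S then F k else G k) =
  \prod_k (F k + G k).
Proof. by rewrite bigA_distr; apply: eq_bigl => S. Qed.

Lemma prod_if_card {K : finType} {R : comPzRingType} (A : {set K}) (c : R) :
  \prod_k (if k \in A then c else 1) = c ^+ #|A|.
Proof. by rewrite -big_mkcond prodr_const. Qed.

Lemma sum_expr_card {K : finType} {R : comPzRingType} (c : R) :
  \sum_(S : {set K}) c ^+ #|S| = (c + 1) ^+ #|K|.
Proof.
rewrite -(prodr_const K) -sum_set_prod; apply: eq_bigr => S _.
by rewrite prod_if_card.
Qed.

Lemma union_bound {K X : finType} {R : numDomainType} (w : X -> R)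
    (A : pred X) (P : pred K) (B : K -> pred X) :
    (forall a, 0 <= w a) ->
    (forall a, A a -> exists2 k, P k & B k a) ->
  \sum_(a | A a) w a <= \sum_(k | P k) \sum_(a | B k a) w a.
Proof.
move=> w0 AB; rewrite [leRHS](exchange_big_dep predT) //= big_mkcond.
apply: ler_sum => a _; case: ifPn => [/AB[k Pk Bka]|_]; last exact: sumr_ge0.
by rewrite (bigD1 k) ?Pk //= lerDl sumr_ge0.
Qed.

Section RowModel.
Context {R : realType} {m n : nat}.
Implicit Types (E : {set 'I_m * 'I_n}) (i : 'I_m) (C : {set 'I_n}).

Definition bip_row E i : {set 'I_n} := [set j | (i, j) \in E]%SET.

Definition row_reach E i (T : {set 'I_m}) : {set 'I_n} :=
  [set j in bip_row E i | [exists t in T, (t, j) \in E]]%SET.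

Definition row_expanding (D : R) E i (T : {set 'I_m}) : bool :=
  (2 * #|bip_row E i| <= 3 * #|row_reach E i T|)%N
  || (2 * #|T|%:R * #|bip_row E i|%:R <= D * #|row_reach E i T|%:R).

(** Only the first part is tested; the second is handled by transposing the edge set. *)
Definition rows_expanding (D : R) E : bool :=
  [forall i, (D <= #|bip_row E i|%:R) &&
     [forall T : {set 'I_m}, (T != finset.set0) && (i \notin T) ==>
        row_expanding D E i T]].

Variable p : R.
Hypothesis p01 : 0 <= p <= 1.

Let p0 : 0 <= p. Proof. by case/andP: p01. Qed.
Let q0 : 0 <= 1 - p. Proof. by rewrite subr_ge0; case/andP: p01. Qed.
Let q1 : 1 - p <= 1. Proof. by rewrite gerDl oppr_le0. Qed.

Local Notation weight := (@bip_weight m n R p).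

Lemma bip_weight_ge0 E : 0 <= weight E.
Proof. by apply: prodr_ge0 => ij _; case: ifP. Qed.

Lemma sum_bip_weight : \sum_E weight E = 1.
Proof. by rewrite sum_set_prod big1 // => ij _; rewrite addrC subrK. Qed.

Definition row_weight C : R := \prod_j (if j \in C then p else 1 - p).

Lemma row_weight_ge0 C : 0 <= row_weight C.
Proof. by apply: prodr_ge0 => j _; case: ifP. Qed.

Lemma sum_row_weight : \sum_C row_weight C = 1.
Proof. by rewrite sum_set_prod big1 // => j _; rewrite addrC subrK. Qed.

Definition no_edge E (T : {set 'I_m}) C : bool :=
  [forall t in T, forall j in C, (t, j) \notin E].

(** Since [i] is not in [T], the prescribed row and the forbidden rectangle concern disjoint sets of
    independent edges, so the probability factors. *)
Lemma sum_fixed_row i (T : {set 'I_m}) C (B : {set 'I_n}) : i \notin T ->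
  \sum_(E | (bip_row E i == C) && no_edge E T B) weight E =
  row_weight C * (1 - p) ^+ (#|T| * #|B|).
Proof.
move=> iT.
(* [f] and [g] are the weights of a present and of an absent edge, set to 0 for excluded choices;
   the constrained sum thus becomes a full sum of products. *)
pose f (ij : 'I_m * 'I_n) :=
  if ij.1 == i then (if ij.2 \in C then p else 0)
  else if (ij.1 \in T) && (ij.2 \in B) then 0 else p.
pose g (ij : 'I_m * 'I_n) :=
  if ij.1 == i then (if ij.2 \in C then 0 else 1 - p) else 1 - p.
transitivity (\sum_(E : {set _ * _}) \prod_ij (if ij \in E then f ij else g ij)).
  rewrite big_mkcond; apply: eq_bigr => E _; case: ifPn => [/andP[/eqP rC nE]|].
    apply: eq_bigr => -[a b] _; rewrite /f /g /=.
    have [ai|ai] := eqVneq a i; first by rewrite -rC inE ai; case: ifP.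
    case: ifP => // abE; case: ifP => // /andP[aT bB].
    have /forall_inP/(_ a aT)/forall_inP/(_ b bB) := nE.
    by rewrite abE.
  rewrite negb_and => /orP[rC|].
    have [b bP] : exists b, (b \in bip_row E i) != (b \in C).
      apply/existsP; apply: contraR rC; rewrite negb_exists => /forallP h.
      by apply/eqP/setP => b; have := h b; rewrite negbK => /eqP.
    rewrite (bigD1 (i, b)) //= /f /g /= eqxx; move: bP; rewrite inE.
    by case: ((i, b) \in E); case: (b \in C); rewrite ?mul0r.
  rewrite negb_forall => /existsP[a]; rewrite negb_imply => /andP[aT].
  rewrite negb_forall => /existsP[b]; rewrite negb_imply negbK => /andP[bB abE].
  rewrite (bigD1 (a, b)) //= abE /f /= aT bB.
  by rewrite ifN ?mul0r //; apply: contraNneq iT => <-.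
rewrite sum_set_prod -(pair_bigA _ (fun a b => f (a, b) + g (a, b))) /=.
rewrite (bigD1 i) //=; congr (_ * _).
  apply: eq_bigr => b _; rewrite /f /g /= eqxx.
  by case: ifP; rewrite ?addr0 ?add0r.
rewrite mulnC exprM -(prod_if_card T) [RHS](bigD1 i) //= (negbTE iT) mul1r.
apply: eq_bigr => a /negbTE ai; rewrite /f /g /= ai.
case: (a \in T) => /=; last by rewrite big1 // => b _; rewrite addrC subrK.
rewrite -prod_if_card; apply: eq_bigr => b _.
by case: (b \in B); rewrite ?add0r // addrC subrK.
Qed.

(** Conditioning on row [i] lets the forbidden set [B] depend on that row. *)
Lemma sum_row_cond i (T : {set 'I_m}) (Phi : pred {set 'I_n})
    (B : {set 'I_n} -> {set 'I_n}) : i \notin T ->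
  \sum_(E | Phi (bip_row E i) && no_edge E T (B (bip_row E i))) weight E =
  \sum_(C | Phi C) row_weight C * (1 - p) ^+ (#|T| * #|B C|).
Proof.
move=> iT; rewrite (partition_big (fun E => bip_row E i) Phi) /=; last first.
  by move=> E /andP[].
apply: eq_bigr => C PhiC; rewrite -(sum_fixed_row i) //; apply: eq_bigl => E.
by apply/andP/andP=> [[/andP[_ h] /eqP eC]|[/eqP eC h]];
   rewrite ?eC in h *; rewrite ?eqxx ?PhiC.
Qed.

Section Bounds.
(** In the application [L] is the logarithm of [N = m + n] and [x] is [1 / N]. *)
Variables (D L x : R).
Hypotheses (D0 : 0 < D) (L0 : 0 <= L) (xE : x = expR (- L)).
Hypotheses (mx : m%:R * x <= 1) (nx : n%:R * x <= 1).
Hypotheses (Dn : 4 * D <= n%:R * p) (pD : 15 * L <= p * D).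

Let x0 : 0 <= x. Proof. by rewrite xE expR_ge0. Qed.
Let x1 : x <= 1. Proof. by rewrite xE -expR0 ler_expR oppr_le0. Qed.
Let p1 : p <= 1. Proof. by case/andP: p01. Qed.

Lemma expr1Dx_le (k : nat) : k%:R * x <= 1 -> (x + 1) ^+ k <= expR 1.
Proof.
move=> kx; apply: (@le_trans _ _ (expR x ^+ k)).
  by apply: lerXn2r; rewrite ?nnegrE ?addr_ge0 ?expR_ge0 // addrC expR_ge1Dx.
by rewrite -expRM_natl ler_expR.
Qed.

Lemma onem_expr_le (k : nat) : (1 - p) ^+ k <= expR (- (p * k%:R)).
Proof.
rewrite -mulNr expRM_natr; apply: lerXn2r; rewrite ?nnegrE ?expR_ge0 //.
exact: expR_ge1Dx.
Qed.

(** Chernoff's method: the mean of 2 to the power minus the degree is [(1 - p / 2) ^+ n], at most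
    [expR (- (2 * D))]. Markov's inequality costs a factor [expR D], and [D >= p * D >= 15 * L]. *)
Lemma small_row_prob i :
  \sum_(E | #|bip_row E i|%:R < D) weight E <= x ^+ 2.
Proof.
have -> : \sum_(E | #|bip_row E i|%:R < D) weight E =
    \sum_(C : {set 'I_n} | #|C|%:R < D) row_weight C.
  (* With [T] empty the absence of edges is trivial, and [sum_row_cond] yields the law of row
     [i]. *)
  rewrite [RHS](eq_bigr (fun C : {set 'I_n} => row_weight C *
    (1 - p) ^+ (#|@finset.set0 'I_m| * #|C|))).
    rewrite -(sum_row_cond i _ (fun C : {set 'I_n} => #|C|%:R < D) id) ?inE //.
    apply: eq_bigl => E; rewrite [no_edge _ _ _](_ : _ = true) ?andbT //.
    by apply/forall_inP => t; rewrite inE.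
  by move=> C _; rewrite cards0 mul0n expr0 mulr1.
have e2 : 2 <= expR 1 :> R by rewrite -[2]/(1 + 1) expR_ge1Dx.
apply: (@le_trans _ _ (expR D * \sum_(C : {set 'I_n}) row_weight C * 2^-1 ^+ #|C|)).
  rewrite mulr_sumr big_mkcond; apply: ler_sum => C _; case: ifP => [CD|_].
    rewrite mulrCA ler_peMr ?row_weight_ge0 // exprVn ler_pdivlMr ?exprn_gt0 //.
    rewrite mul1r; apply: (@le_trans _ _ (expR 1 ^+ #|C|)).
      by apply: lerXn2r; rewrite ?nnegrE ?expR_ge0.
    by rewrite -expRM_natl mulr1 ler_expR ltW.
  by rewrite mulr_ge0 ?expR_ge0 // mulr_ge0 ?row_weight_ge0 // exprn_ge0.
have -> : \sum_(C : {set 'I_n}) row_weight C * 2^-1 ^+ #|C| = (1 - p / 2) ^+ n.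
  under eq_bigr => C _ do rewrite -prod_if_card -big_split /=.
  transitivity (\prod_(j < n) (p / 2 + (1 - p))).
    rewrite -sum_set_prod; apply: eq_bigr => C _; apply: eq_bigr => j _.
    by case: ifP; rewrite ?mulr1.
  by rewrite prodr_const card_ord; congr (_ ^+ _); field.
apply: (@le_trans _ _ (expR D * expR (- (p / 2) * n%:R))).
  rewrite ler_pM2l ?expR_gt0 // expRM_natr; apply: lerXn2r.
  - by move: p0 p1; rewrite nnegrE; lra.
  - by rewrite nnegrE expR_ge0.
  - exact: expR_ge1Dx.
rewrite -expRD xE -expRM_natl ler_expR.
have : p * D <= D by rewrite ler_piMl // ltW.
have -> : - (p / 2) * n%:R = - (n%:R * p / 2) by rewrite mulNr mulrAC [p * _]mulrC.
move: Dn pD L0; set a := n%:R * p; set b := p * D; lra.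
Qed.

Lemma non_expanding_prob i (T : {set 'I_m}) :
    T != finset.set0 -> i \notin T ->
  \sum_(E | (D <= #|bip_row E i|%:R) && ~~ row_expanding D E i T)
    weight E <= expR 1 * x ^+ (3 * #|T|).
Proof.
move=> T0 iT.
(* [S] ranges over candidates for [row_reach E i T]; given the row [C], no edge may join [T] to
   [C :\: S]. *)
pose Phi (S C : {set 'I_n}) := [&& D <= #|C|%:R, (3 * #|S| < 2 * #|C|)%N
  & D * #|S|%:R < 2 * #|T|%:R * #|C|%:R].
pose B (S : {set 'I_n}) E :=
  Phi S (bip_row E i) && no_edge E T (bip_row E i :\: S)%SET.
apply: (@le_trans _ _ (\sum_(S : {set 'I_n}) \sum_(E | B S E) weight E)).
  apply: union_bound => [E|E /andP[DE]]; first exact: bip_weight_ge0.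
  rewrite negb_or -ltnNge -real_ltNge ?num_real // => /andP[h1 h2].
  exists (row_reach E i T) => //; rewrite /B /Phi DE h1 h2 /=.
  apply/forall_inP => t tT; apply/forall_inP => j; rewrite !inE => /andP[+ jr].
  by rewrite jr /=; apply: contra => tj; apply/exists_inP; exists t.
apply: (@le_trans _ _ (\sum_(S : {set 'I_n}) x ^+ #|S| * x ^+ (3 * #|T|))); last first.
  rewrite -mulr_suml sum_expr_card card_ord ler_wpM2r ?exprn_ge0 //.
  exact: expr1Dx_le.
apply: ler_sum => S _.
rewrite /B (sum_row_cond i T (Phi S) (fun C : {set 'I_n} => C :\: S)%SET iT).
rewrite -[leRHS]mul1r -[X in _ <= X * _]sum_row_weight mulr_suml big_mkcond.
apply: ler_sum => C _; case: ifP => [/and3P[DC h1 h2]|_]; last first.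
  by rewrite !mulr_ge0 ?exprn_ge0 ?row_weight_ge0.
rewrite ler_wpM2l ?row_weight_ge0 //; apply: le_trans (onem_expr_le _) _.
rewrite xE -!expRM_natl -expRD ler_expR.
set s : R := #|S|%:R in h2 *; set c : R := #|C|%:R in DC h2 *.
have t1 : 1 <= #|T|%:R :> R by rewrite ler1n card_gt0.
rewrite !natrM; set t : R := #|T|%:R in h2 t1 *.
have cS : c / 3 <= #|(C :\: S)%SET|%:R.
  have : (#|C| <= 3 * #|C :\: S|%SET)%N.
    move: h1 (cardsID S C) (subset_leq_card (finset.subsetIr C S)); clear; lia.
  by rewrite -(ler_nat R) natrM; lra.
set d : R := #|(C :\: S)%SET|%:R in cS *.
have pd : p * (t * (c / 3)) <= p * (t * d).
  by rewrite ler_wpM2l // ler_wpM2l //; lra.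
(* In units of [k], [s] is at most 2 and [t] at most 1, so [s + 3 * t <= 5 * k]. The available
   exponent is [k * (p * D) / 3 >= 5 * k * L], which is where the 15 comes from. *)
pose k := t * c / D.
have sk : s <= 2 * k by rewrite /k mulrA ler_pdivlMr //; nra.
have tk : t <= k by rewrite /k ler_pdivlMr // ler_wpM2l //; lra.
have kD : p * (t * (c / 3)) = k * (p * D) / 3 by rewrite /k; field; exact: lt0r_neq0.
have k0 : 0 <= k by lra.
have := ler_wpM2l k0 pD.
have := ler_wpM2l L0 sk; have := ler_wpM2l L0 tk.
by lra.
Qed.

(** Each row is bad with probability O([x ^+ 2]); the union over [m] rows costs one factor [x], as
    [m%:R * x <= 1]. *)
Lemma rows_expanding_prob :
  \sum_(E | ~~ rows_expanding D E) weight E <= (expR 1 ^+ 2 + 1) * x.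
Proof.
pose bad i E := (#|bip_row E i|%:R < D) || [exists T : {set 'I_m},
  [&& T != finset.set0, i \notin T & (D <= #|bip_row E i|%:R)
   && ~~ row_expanding D E i T]].
have badP i : \sum_(E | bad i E) weight E <= (expR 1 ^+ 2 + 1) * x ^+ 2.
  apply: (@le_trans _ _ (\sum_(E | #|bip_row E i|%:R < D) weight E +
     \sum_(T : {set 'I_m} | (T != finset.set0) && (i \notin T))
       \sum_(E | (D <= #|bip_row E i|%:R) && ~~ row_expanding D E i T)
          weight E)).
    apply: (@le_trans _ _ (\sum_(b : bool) \sum_(E | if b then #|bip_row E i|%:R < D
        else bad i E && (D <= #|bip_row E i|%:R)) weight E)).
      apply: union_bound => [E|E bE]; first exact: bip_weight_ge0.
      have [DE|DE] := leP D #|bip_row E i|%:R; first by exists false => //; rewrite bE.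
      by exists true.
    rewrite big_bool /= lerD2l; apply: union_bound => [E|E]; first exact: bip_weight_ge0.
    rewrite /bad => /andP[+ DE]; rewrite ltNge DE /= => /existsP[T /and3P[T0 iT h]].
    by exists T; rewrite ?T0.
  rewrite mulrDl mul1r addrC; apply: lerD; last exact: small_row_prob.
  apply: (@le_trans _ _ (\sum_(T : {set 'I_m}) expR 1 * (x ^+ 2 * x ^+ #|T|))).
    rewrite big_mkcond; apply: ler_sum => T _; case: ifP => [/andP[T0 iT]|_]; last first.
      by rewrite !mulr_ge0 ?expR_ge0 ?exprn_ge0.
    apply: le_trans (non_expanding_prob _ _ T0 iT) _.
    (* As [T] is nonempty, [3 * #|T| >= 2 + #|T|]: [x ^+ 2] factors out and the rest sums to
       [(x + 1) ^+ m]. *)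
    rewrite ler_pM2l ?expR_gt0 // -exprD ler_wiXn2l //.
    by move: T0; rewrite -card_gt0; clear; lia.
  rewrite -!mulr_sumr sum_expr_card card_ord [expR 1 ^+ 2]expr2 -mulrA ler_pM2l ?expR_gt0 //.
  by rewrite mulrC ler_wpM2r ?exprn_ge0 // expr1Dx_le.
apply: (@le_trans _ _ (\sum_(i < m) \sum_(E | bad i E) weight E)).
  apply: union_bound => [E|E]; first exact: bip_weight_ge0.
  rewrite negb_forall => /existsP[i]; rewrite negb_and -ltNge => hi; exists i => //.
  rewrite /bad; have [//|DE] := ltP #|bip_row E i|%:R D.
  move: hi; rewrite ltNge DE /= negb_forall => /existsP[T].
  rewrite negb_imply => /andP[/andP[T0 iT] h]; apply/existsP; exists T.
  by rewrite T0 iT.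
apply: (le_trans (ler_sum _ (fun i _ => badP i))).
rewrite sumr_const card_ord -mulr_natl mulrCA.
rewrite ler_wpM2l ?addr_ge0 ?exprn_ge0 ?expR_ge0 //.
by rewrite expr2 mulrA ler_piMl.
Qed.

End Bounds.
End RowModel.

(** * Exchanging the two parts, and the limit *)

Definition transpose_edges {m n : nat} (E : {set 'I_m * 'I_n}) : {set 'I_n * 'I_m} :=
  [set ji | (ji.2, ji.1) \in E]%SET.

Lemma transpose_edgesK m n :
  cancel (@transpose_edges m n) (@transpose_edges n m).
Proof. by move=> E; apply/setP => -[i j]; rewrite !inE. Qed.

Lemma bip_weight_transpose {R : realType} m n (p : R) (E : {set 'I_m * 'I_n}) :
  bip_weight p (transpose_edges E) = bip_weight p E.
Proof.
rewrite /bip_weight (reindex (fun ij : 'I_m * 'I_n => (ij.2, ij.1))) /=.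
  by apply: eq_bigr => -[i j] _; rewrite inE.
by exists (fun ji : 'I_n * 'I_m => (ji.2, ji.1)) => -[].
Qed.

(* [f] and [g] embed the two parts, so that the two orientations of the
   bipartition are treated at once. *)
Lemma rows_expanding_graph {R : realType} {m n : nat} {T : finType} (e : rel T)
    (f : 'I_m -> T) (g : 'I_n -> T) (D : R) (E : {set 'I_m * 'I_n}) :
    symmetric e -> injective f -> injective g ->
    (forall i j, e (f i) (g j) = ((i, j) \in E)) ->
    (forall i z, e (f i) z -> exists j, z = g j) ->
    (forall j z, e (g j) z -> exists i, z = f i) ->
    rows_expanding D E -> forall i,
  D <= (degree e (f i))%:R /\
  forall z (S : {set T}), e (f i) z ->
    S != finset.set0 -> S \subset (nbrs e z :\ f i)%SET ->
    (2 * degree e (f i) <= 3 * #|nbrs e (f i) :&: image_rel e S|%SET)%N \/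
    2 * #|S|%:R * (degree e (f i))%:R
      <= D * #|nbrs e (f i) :&: image_rel e S|%SET%:R.
Proof.
move=> e_sym f_inj g_inj efg adjf adjg /forallP expE i.
have /andP[DE /forallP expEi] := expE i.
have rowE : nbrs e (f i) = (g @: bip_row E i)%SET.
  apply/setP => z; rewrite inE; apply/idP/imsetP => [efz|[j + ->]].
    by have [j zE] := adjf i z efz; exists j; rewrite // inE -efg -zE.
  by rewrite inE efg.
have degE : degree e (f i) = #|bip_row E i|.
  by rewrite -(card_imset _ g_inj) -rowE.
rewrite degE; split=> // z S efz S0 sS.
pose U := (f @^-1: S)%SET.
have SE : S = (f @: U)%SET.
  apply/setP => u; apply/idP/imsetP => [uS|[t + ->]]; last by rewrite inE.
  have := fintype.subsetP sS u uS; rewrite !inE => /andP[_ ezu].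
  have [j zE] := adjf i z efz; rewrite zE in ezu.
  by have [t uE] := adjg j u ezu; exists t; rewrite // inE -uE.
have cS : #|S| = #|U| by rewrite SE card_imset.
have reachE : (nbrs e (f i) :&: image_rel e S)%SET = (g @: row_reach E i U)%SET.
  apply/setP => w; rewrite finset.in_setI rowE; apply/andP/imsetP.
    case=> /imsetP[j jr ->] /image_relP[u]; rewrite SE => /imsetP[t tU ->].
    rewrite efg => tj; exists j => //; rewrite inE jr.
    by apply/exists_inP; exists t.
  case=> j; rewrite inE => /andP[jr /exists_inP[t tU tj]] ->.
  split; first exact: imset_f.
  by apply/image_relP; exists (f t); rewrite ?efg // SE imset_f.
have U0 : U != finset.set0 by rewrite -card_gt0 -cS card_gt0.
have iU : i \notin U.
  by rewrite inE; apply/negP => /(fintype.subsetP sS); rewrite !inE eqxx.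
have := expEi U; rewrite U0 iU /= /row_expanding reachE card_imset // cS.
by move/orP.
Qed.

Lemma rows_expanding_positively_curved {R : realType} {m n : nat} (D : R)
    (E : {set 'I_m * 'I_n}) : 3 <= D ->
  rows_expanding D E -> rows_expanding D (transpose_edges E) ->
  positively_curved (bip_adj E) R.
Proof.
move=> D3 expE expE'.
have inlP := rows_expanding_graph (bip_adj E) inl inr D E
  (bip_adj_sym E) (@inl_inj _ _) (@inr_inj _ _) (fun _ _ => erefl).
have inrP := rows_expanding_graph (bip_adj E) inr inl D (transpose_edges E)
  (bip_adj_sym E) (@inr_inj _ _) (@inl_inj _ _).
have adjl i z : bip_adj E (inl i) z -> exists j, z = inr j.
  by case: z => // j _; exists j.
have adjr j z : bip_adj E (inr j) z -> exists i, z = inl i.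
  by case: z => // i _; exists i.
have {}inlP := inlP adjl adjr expE.
have trE j i : bip_adj E (inr j) (inl i) = ((j, i) \in transpose_edges E).
  by rewrite inE.
have {}inrP := inrP trE adjr adjl expE'.
apply: (expansion_positively_curved _ D) => //.
- exact: bip_adj_sym.
- exact: bip_adj_irr.
- by case=> [i|j]; [case: (inlP i)|case: (inrP j)].
- by case=> [i|j] z S; [case: (inlP i) => _|case: (inrP j) => _]; apply.
Qed.

Lemma bip_prob_le1 {R : realType} {m n : nat} (p : R)
    (A : rel ('I_m + 'I_n) -> Prop) : 0 <= p <= 1 -> bip_prob p A <= 1.
Proof.
move=> p01; rewrite -(@sum_bip_weight R m n p) /bip_prob big_mkcond.
by apply: ler_sum => E _; case: ifP => // _; apply: bip_weight_ge0.
Qed.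

(** The constant is [60 = 4 * 15]: with [D] a quarter of [p] times the smaller part, it yields
    [15 * L <= p * D], while [4 * D] is at most the mean degree on either side. *)
Lemma positively_curved_prob {R : realType} (m n : nat) (p : R) :
    (0 < m)%N -> (0 < n)%N -> 0 <= p <= 1 ->
    60 * ln ((m + n)%:R : R) <= p ^+ 2 * (minn m n)%:R ->
  1 - 2 * (expR 1 ^+ 2 + 1) / (m + n)%:R
    <= bip_prob p (fun G : rel ('I_m + 'I_n) => positively_curved G R).
Proof.
move=> m0 n0 p01 hp; have /andP[p0 p1] := p01.
set L := ln _ in hp; pose x : R := (m + n)%:R^-1.
have N0 : 0 < (m + n)%:R :> R by rewrite ltr0n addn_gt0 m0.
(* This crude bound on the logarithm gives [D >= p * D >= 15 / 2], hence [3 <= D]. *)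
have L2 : 2^-1 <= L.
  have N2 : 2 <= (m + n)%:R :> R by rewrite ler_nat; lia.
  apply: (@le_trans _ _ (ln 2)); last by rewrite ler_ln ?posrE.
  have : ln (1 + - 2^-1) <= - 2^-1 :> R by apply: le_ln1Dx; lra.
  have -> : 1 + - 2^-1 = 2^-1 :> R by field.
  by rewrite lnV ?posrE // lerN2.
have xE : x = expR (- L) by rewrite expRN lnK // posrE.
have x_le k : (k <= m + n)%N -> k%:R * x <= 1.
  by move=> kN; rewrite ler_pdivrMr // mul1r ler_nat.
pose D : R := p * (minn m n)%:R / 4.
have pD : 15 * L <= p * D by move: hp; rewrite /D expr2; lra.
have D0 : 0 <= D by rewrite divr_ge0 // mulr_ge0.
have pDD : p * D <= D by rewrite ler_piMl.
have D3 : 3 <= D by lra.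
have Dk k : (minn m n <= k)%N -> 4 * D <= k%:R * p.
  move=> le_k; have -> : 4 * D = (minn m n)%:R * p by rewrite /D; field.
  by rewrite ler_wpM2r // ler_nat.
have D_gt0 : 0 < D by lra.
have L0 : 0 <= L by lra.
have mx := x_le m (leq_addr _ _); have nx := x_le n (leq_addl _ _).
have bad_rows := @rows_expanding_prob R m n p p01 D L x D_gt0 L0 xE mx nx
  (Dk n (geq_minr _ _)) pD.
have bad_cols := @rows_expanding_prob R n m p p01 D L x D_gt0 L0 xE nx mx
  (Dk m (geq_minl _ _)) pD.
rewrite lerBlDr -[leLHS](@sum_bip_weight R m n p) /bip_prob.
rewrite (bigID (fun E => `[< positively_curved (bip_adj E) R >])) /= lerD2l.
(* If positive curvature fails, expansion fails for the rows or, after transposition, for the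
   columns. *)
apply: (@le_trans _ _ (\sum_(b : bool) \sum_(E : {set 'I_m * 'I_n} |
    if b then ~~ rows_expanding D E else ~~ rows_expanding D (transpose_edges E))
    bip_weight p E)).
  apply: union_bound => [E|E]; first exact: bip_weight_ge0.
  apply: contraNP => nob; apply/asboolP.
  apply: rows_expanding_positively_curved D3 _ _; apply/negPn/negP => bad.
    by apply: nob; exists true.
  by apply: nob; exists false.
rewrite big_bool /=.
have -> : \sum_(E : {set 'I_m * 'I_n} | ~~ rows_expanding D (transpose_edges E))
    bip_weight p E = \sum_(E : {set 'I_n * 'I_m} | ~~ rows_expanding D E) bip_weight p E.
  rewrite [RHS](reindex (@transpose_edges m n)); last first.
    by exists (@transpose_edges n m) => E _; rewrite transpose_edgesK.
  by apply: eq_bigr => E _; rewrite bip_weight_transpose.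
by rewrite -/x; lra.
Qed.

Theorem theorem1p4 (R : realType) (m n : nat -> nat) (p : nat -> R)
  (m_gt0 : forall k, (0 < m k)%N) (n_gt0 : forall k, (0 < n k)%N)
  (p01 : forall k, 0 <= p k <= 1)
  (N_oo : (m k + n k)%N @[k --> \oo] --> \oo)
  (p2s_oo : p k ^+ 2 * (minn (m k) (n k))%:R / ln ((m k + n k)%:R : R)
              @[k --> \oo] --> +oo) :
  bip_prob (p k) (fun G : rel ('I_(m k) + 'I_(n k)) => positively_curved G R)
    @[k --> \oo] --> (1 : R).
Proof.
pose lower k : R := 1 - 2 * (expR 1 ^+ 2 + 1) / (m k + n k)%:R.
apply: (@squeeze_cvgr _ _ _ _ lower (fun=> 1)); last exact: cvg_cst.
  near=> k; rewrite bip_prob_le1 // andbT; apply: positively_curved_prob => //.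
  (* Both parts are nonempty, so [N >= 2] and the logarithm can be cleared from the ratio, which is
     eventually at least 60. *)
  have ln_gt0 : 0 < ln ((m k + n k)%:R : R).
    by rewrite ln_gt0 // ltr1n; have := m_gt0 k; have := n_gt0 k; lia.
  by rewrite -ler_pdivlMr //; near: k; move/cvgryPge: p2s_oo; apply.
rewrite -[X in _ --> X]subr0; apply: cvgB; first exact: cvg_cst.
rewrite -(mulr0 (2 * (expR 1 ^+ 2 + 1))); apply: cvgMr.
apply/gtr0_cvgV0; last exact/cvgrnyP.
by near=> k; rewrite ltr0n addn_gt0 m_gt0.
Unshelve. all: by end_near. Qed.
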